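(* In the setting fixed in the context (with $p$ prime, $n$ a positive multiple of $p-1$, $u\in\mathbb{Z}_p^\times$, groups $F_0$, $\widetilde{F_0}\subset\widetilde{F_1}\subset\widetilde{F_2}$ and field $L=\mathbb{Q}_p(\widetilde{F_2})$), let $W$ be a subgroup of $\mathrm{Aut}(F_0)$ which lifts to $\mathrm{Aut}(L,\widetilde{F_2},F_0)$. If the set $\widetilde{\mathcal{F}}_u(N_{\mathbb{D}_n^\times}(F_0),\widetilde{F_2},W)$ is non-empty and contains $\widetilde{F_3}$, then there is a bijection $$\psi_3:H^1(W,C_{\mathbb{D}_n^\times}(\widetilde{F_2})/\widetilde{F_2})\longrightarrow\widetilde{\mathcal{F}}_u(N_{\mathbb{D}_n^\times}(F_0),\widetilde{F_2},W)/\!\sim_{C_{\mathbb{D}_n^\times}(\widetilde{F_2})},\qquad c\longmapsto\langle\widetilde{F_2},c\,s_{\widetilde{F_3}}\rangle,$$ for $c$ a cocycle and $s_{\widetilde{F_3}}:W\to\widetilde{F_3}$ a set theoretic section of the epimorphism $\widetilde{F_3}\to W$.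
   Context: $\mathbb{D}_n$ is the central division algebra over $\mathbb{Q}_p$ of Hasse invariant $1/n$, $\mathcal{O}_n$ its maximal order, $\mathbb{S}_n=\mathcal{O}_n^\times$, and $S_n$ the kernel of the reduction $\mathcal{O}_n^\times\to\mathbb{F}_{p^n}^\times$ (the $p$-Sylow subgroup of $\mathbb{S}_n$); $v$ is the valuation on $\mathbb{D}_n$ with $v(p)=1$, so $v(\mathbb{D}_n^\times)=\frac1n\mathbb{Z}$. $\mathbb{Q}_p(H)$ is the $\mathbb{Q}_p$-subalgebra of $\mathbb{D}_n$ generated by $H$; $C_{\mathbb{D}_n^\times}$ and $N_{\mathbb{D}_n^\times}$ denote centralizer and normalizer. Setting: $F_0$ is an abelian finite subgroup of $\mathbb{S}_n$ and $\widetilde{F_0}=F_0\times\langle pu\rangle$. $\widetilde{F_1}$ is a subgroup of $\mathbb{Q}_p(F_0)^\times$ containing $\widetilde{F_0}$ with finite index such that $v$ induces an injection $\widetilde{F_1}/\widetilde{F_0}\hookrightarrow\frac1n\mathbb{Z}/\mathbb{Z}$. $\widetilde{F_2}$ is a subgroup of $C_{\mathbb{D}_n^\times}(F_0)$ containing $\langle pu\rangle$ with finite index such that $\widetilde{F_2}\cap\mathbb{Q}_p(F_0)^\times=\widetilde{F_1}$ and $v$ induces an injection $\widetilde{F_2}/\widetilde{F_1}\hookrightarrow\frac1n\mathbb{Z}/v(\widetilde{F_1})$; $\widetilde{F_2}$ is abelian and $L=\mathbb{Q}_p(\widetilde{F_2})$ is a commutative subfield of $\mathbb{D}_n$. $\widetilde{\mathcal{F}}_u(N_{\mathbb{D}_n^\times}(F_0),\widetilde{F_2})$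 is the set of subgroups $\widetilde{F_3}$ of $N_{\mathbb{D}_n^\times}(F_0)$ containing $\langle pu\rangle$ as a subgroup of finite index such that $\widetilde{F_3}\cap C_{\mathbb{D}_n^\times}(F_0)=\widetilde{F_2}$ and $\widetilde{F_2}$ is normal in $\widetilde{F_3}$. Standing assumption: the following exceptional situation does not occur for a member $\widetilde{F}$ of this set: $p=2$, $n\equiv2\bmod4$, $F_0\cap S_n\cong C_4$, $\widetilde{F}\cap S_n\cong Q_8$, and the $p'$-part of the center of $\widetilde{F}\cap\mathbb{S}_n$ is isomorphic to the $p'$-part of $F_0$. $\mathrm{Aut}(L,\widetilde{F_2},F_0)$ is the group of field automorphisms of $L$ leaving both $\widetilde{F_2}$ and $F_0$ invariant. $W$ lifts to it if there is a subgroup of $\mathrm{Aut}(L,\widetilde{F_2},F_0)$ mapped isomorphically onto $W$ by restriction to $F_0$; $W$ is identified with such a lift. Conjugation induces injective homomorphisms of $\widetilde{F_3}/\widetilde{F_2}$ into $\mathrm{Aut}(L,\widetilde{F_2},F_0)$ and into $\mathrm{Aut}(F_0)$. $\widetilde{\mathcal{F}}_u(N_{\mathbb{D}_n^\times}(F_0),\widetilde{F_2},W)$ is the set of those $\widetilde{F_3}\in\widetilde{\mathcal{F}}_u(N_{\mathbb{D}_n^\times}(F_0),\widetilde{F_2})$ with $\widetilde{F_3}/\widetilde{F_2}=W$ under this identification; $\sim_{C_{\mathbb{D}_n^\times}(\widetilde{F_2})}$ denotes conjugation by elements of $C_{\mathbb{D}_n^\times}(\widetilde{F_2})$, and the quotient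 is the set of orbits. $H^1$ is (nonabelian) group cohomology; $W=\widetilde{F_3}/\widetilde{F_2}$ acts on $C_{\mathbb{D}_n^\times}(\widetilde{F_2})/\widetilde{F_2}$ through conjugation by $\widetilde{F_3}$. $\langle\widetilde{F_2},c\,s_{\widetilde{F_3}}\rangle$ is the subgroup generated by $\widetilde{F_2}$ and the elements $\tilde c(w)s_{\widetilde{F_3}}(w)$, $w\in W$, with $\tilde c(w)\in C_{\mathbb{D}_n^\times}(\widetilde{F_2})$ a representative of $c(w)$. *)

(* Defs.v *)
From HB Require Import structures.
From mathcomp Require Import all_boot all_order all_algebra fraction falgebra fingroup.
From mathcomp Require extremal.
From mathcomp Require Import all_classical.

Set Implicit Arguments.
Unset Strict Implicit.
Unset Printing Implicit Defensive.

Import Order.TTheory GRing.Theory Num.Theory.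

(* The p-adic integers, as the inverse limit of the rings Z/p^k: the k-th
   component is represented by a natural number smaller than p^k. The proof
   that p is prime is a parameter of the type because it is used to show that
   the ring is an integral domain. *)
Definition coherent (p : nat) : pred (nat -> nat) :=
  fun x => `[< forall k, (x k.+1 %% p ^ k)%N = x k >].

Record padic_int (p : nat) (p_pr : prime p) := PadicInt {
  padic_comp :> nat -> nat;
  padic_coherent : coherent p padic_comp }.

Section PadicIntegers.
Local Open Scope nat_scope.

Variables (p : nat) (p_pr : prime p).
Local Notation padic_int := (padic_int p_pr).
Local Notation coherent := (coherent p).

HB.instance Definition _ := [isSub of padic_int for @padic_comp p p_pr].
HB.instance Definition _ := [Choice of padic_int by <:].

Implicit Types x y z : padic_int.

Lemma padicE x k : x k.+1 %% p ^ k = x k.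
Proof. by move: k; apply/asboolP; exact: padic_coherent. Qed.

Lemma padic_mod x i j : i <= j -> x j %% p ^ i = x i.
Proof.
elim: j => [|j IHj]; first by rewrite leqn0 => /eqP->; rewrite -padicE modn_mod.
rewrite leq_eqVlt => /predU1P[->|]; first by rewrite -padicE modn_mod.
rewrite ltnS => le_ij; rewrite -(IHj le_ij) -(padicE x j).
by rewrite modn_dvdm // dvdn_exp2l.
Qed.

Lemma padic_inj x y : (forall k, x k = y k) -> x = y.
Proof. by move=> xy; apply/val_inj/funext. Qed.

Lemma coherent_lift (f : nat -> nat) :
  (forall k, f k.+1 = f k %[mod p ^ k]) -> coherent (fun k => f k %% p ^ k).
Proof.
by move=> fP; apply/asboolP => k; rewrite modn_dvdm ?fP // dvdn_exp2l.
Qed.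

Lemma padic_eqmod x k : x k.+1 = x k %[mod p ^ k].
Proof. by rewrite !padicE padic_mod. Qed.

Fact padic_nat_subproof m : coherent (fun k => m %% p ^ k).
Proof. exact: coherent_lift. Qed.

Fact padic_opp_subproof x : coherent (fun k => (p ^ k - x k) %% p ^ k).
Proof.
have ltx k : x k < p ^ k.
  by rewrite -(@padic_mod x k k) // ltn_mod expn_gt0 prime_gt0.
apply: coherent_lift => k; apply/eqP; rewrite -(eqn_modDr (x k)) subnK ?(ltnW (ltx k)) //.
rewrite -modnDmr -(padic_eqmod x k) modnDmr subnK ?(ltnW (ltx k.+1)) //.
by rewrite expnS modnMl modnn.
Qed.

Fact padic_add_subproof x y : coherent (fun k => (x k + y k) %% p ^ k).
Proof.
apply: coherent_lift => k.
by rewrite -modnDm !padic_eqmod modnDm.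
Qed.

Fact padic_mul_subproof x y : coherent (fun k => (x k * y k) %% p ^ k).
Proof.
apply: coherent_lift => k.
by rewrite -modnMm !padic_eqmod modnMm.
Qed.

Definition padic_nat m : padic_int := PadicInt p_pr (padic_nat_subproof m).
Definition padic_opp x : padic_int := PadicInt p_pr (padic_opp_subproof x).
Definition padic_add x y : padic_int := PadicInt p_pr (padic_add_subproof x y).
Definition padic_mul x y : padic_int := PadicInt p_pr (padic_mul_subproof x y).

Fact padic_addA : associative padic_add.
Proof. by move=> x y z; apply: padic_inj => k /=; rewrite modnDml modnDmr addnA. Qed.

Fact padic_addC : commutative padic_add.
Proof. by move=> x y; apply: padic_inj => k /=; rewrite addnC. Qed.

Fact padic_add0 : left_id (padic_nat 0) padic_add.
Proof. by move=> x; apply: padic_inj => k /=; rewrite mod0n add0n padic_mod. Qed.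

Fact padic_addN : left_inverse (padic_nat 0) padic_opp padic_add.
Proof.
move=> x; apply: padic_inj => k /=; rewrite modnDml mod0n subnK ?modnn //.
by rewrite ltnW // -(@padic_mod x k k) // ltn_mod expn_gt0 prime_gt0.
Qed.

HB.instance Definition _ :=
  GRing.isZmodule.Build padic_int padic_addA padic_addC padic_add0 padic_addN.

Fact padic_mulA : associative padic_mul.
Proof. by move=> x y z; apply: padic_inj => k /=; rewrite modnMml modnMmr mulnA. Qed.

Fact padic_mulC : commutative padic_mul.
Proof. by move=> x y; apply: padic_inj => k /=; rewrite mulnC. Qed.

Fact padic_mul1 : left_id (padic_nat 1) padic_mul.
Proof. by move=> x; apply: padic_inj => k /=; rewrite modnMml mul1n padic_mod. Qed.

Fact padic_mulDl : left_distributive padic_mul padic_add.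
Proof.
by move=> x y z; apply: padic_inj => k /=; rewrite modnMml modnDm mulnDl.
Qed.

Fact padic_oner_neq0 : padic_nat 1 != 0%R.
Proof.
apply/eqP => /(congr1 (fun x : padic_int => x 1)) /=.
by rewrite mod0n expn1 modn_small ?prime_gt1.
Qed.

HB.instance Definition _ := GRing.Zmodule_isComNzRing.Build padic_int
  padic_mulA padic_mulC padic_mul1 padic_mulDl padic_oner_neq0.

Definition padic_unit : {pred padic_int} := fun x => `[< exists y, y * x = 1 >]%R.
Definition padic_inv x := xget x [set y | (y * x = 1)%R]%classic.

Fact padic_mulVx : {in padic_unit, left_inverse 1 padic_inv *%R}%R.
Proof. by move=> x /asboolP[y yx]; exact: (@xgetPex _ x [set y | (y * x = 1)%R]%classic (ex_intro _ y yx)). Qed.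

Fact padic_unitPl x y : (y * x = 1)%R -> padic_unit x.
Proof. by move=> yx; apply/asboolP; exists y. Qed.

Fact padic_inv_out : {in [predC padic_unit], padic_inv =1 id}.
Proof.
by move=> x /asboolP xP; apply: xgetPN => y yx; apply: xP; exists y.
Qed.

HB.instance Definition _ := GRing.ComNzRing_hasMulInverse.Build padic_int
  padic_mulVx padic_unitPl padic_inv_out.

Lemma padic_neq0 x : x <> 0%R -> exists k, ~~ (p ^ k %| x k).
Proof.
move=> /eqP; apply: contraNP => /forallNP xk; apply/eqP/padic_inj => k /=.
by rewrite mod0n -(@padic_mod x k k) //; apply/eqP/negPn/negP/xk.
Qed.

Fact padic_integral : GRing.integral_domain_axiom padic_int.
Proof.
move=> x y /(congr1 (fun z : padic_int => z : nat -> nat)) xy0.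
apply/negPn/negP; rewrite negb_or => /andP[/eqP + /eqP].
move=> /padic_neq0[i ni] /padic_neq0[j nj].
have mod_ij z a b : ~~ (p ^ a %| @padic_comp p p_pr z a) -> ~~ (p ^ a %| @padic_comp p p_pr z (a + b)).
  by rewrite /dvdn !padic_mod ?leq_addr.
have {}ni := mod_ij _ _ j ni; have {}nj := mod_ij _ _ i nj.
rewrite addnC in nj.
have x_gt0 : 0 < x (i + j) by rewrite lt0n; apply: contraNneq ni => ->.
have y_gt0 : 0 < y (i + j) by rewrite lt0n; apply: contraNneq nj => ->.
have /eqP : (x (i + j) * y (i + j)) %% p ^ (i + j) = 0.
  by have /(congr1 (fun f => f (i + j))) := xy0; rewrite /= mod0n.
rewrite -/(dvdn _ _) pfactor_dvdn ?muln_gt0 ?x_gt0 // lognM //.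
rewrite pfactor_dvdn // -ltnNge in ni; rewrite pfactor_dvdn // -ltnNge in nj.
by rewrite leqNgt -addSn leq_add // ltnW.
Qed.

HB.instance Definition _ :=
  GRing.ComUnitRing_isIntegral.Build padic_int padic_integral.

End PadicIntegers.

Notation padic_num p_pr := {fraction padic_int p_pr}.

(* MathComp's {group gT} is restricted to finite groups; the groups below are
   infinite, so their subgroups are bundled classical sets. *)
Record subgroup (G : groupType) := Subgroup {
  subgroup_set :> set G;
  subgroup_closed : group_closed [in subgroup_set] }.

Canonical subgroup_predType (G : groupType) :=
  PredType (fun (H : subgroup G) x => x \in subgroup_set H).

Section Subgroups.
Local Open Scope group_scope.
Local Open Scope classical_set_scope.

Variable G : groupType.
Implicit Types (A B : set G) (H K N : subgroup G) (x y g : G).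

Definition subg_of H := {x : G | x \in (H : set G)}.
HB.instance Definition _ H := SubChoice.on (subg_of H).
HB.instance Definition _ H :=
  SubChoice_isSubGroup.Build G _ (subg_of H) (subgroup_closed H).

Lemma subgroup1 H : 1 \in H. Proof. by have [] := subgroup_closed H. Qed.

Lemma subgroupF H x y : x \in H -> y \in H -> x / y \in H.
Proof. by have [_] := subgroup_closed H; apply. Qed.

Lemma subgroupV H x : x \in H -> x^-1 \in H.
Proof. by move=> Hx; rewrite -[x^-1]mul1g subgroupF ?subgroup1. Qed.

Lemma subgroupM H x y : x \in H -> y \in H -> x * y \in H.
Proof. by move=> Hx Hy; rewrite -[y]invgK subgroupF ?subgroupV. Qed.

Definition mulset A B : set G := [set x * y | x in A & y in B].
Definition lcoset x A : set G := [set x * y | y in A].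
Definition conjset g A : set G := [set g * x * g^-1 | x in A].

Definition isomorphic (G' : groupType) A (B : set G') :=
  exists f : G -> G', set_bij A B f /\ {in A &, {morph f : x y / x * y}}.

Definition abelian_set A := {in A &, forall x y, commute x y}.
Definition prime_to_part (p : nat) A : set G :=
  [set x | x \in A /\ exists m, coprime m p /\ x ^+ m = 1].

Definition center_set A : set G := [set x | x \in A /\ {in A, forall y, commute x y}].

Definition finite_index A B := A `<=` B /\ finite_set [set lcoset x A | x in B].

Definition gen_set A : set G :=
  [set x | forall H, A `<=` H -> x \in H].

Fact gen_closed A : group_closed [in gen_set A].
Proof.
split=> [|x y /set_mem Ax /set_mem Ay]; apply/mem_set => H AH.
  exact: subgroup1.
by rewrite subgroupF ?Ax ?Ay.
Qed.

Definition gen A := Subgroup (gen_closed A).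
Definition cycle_gen x := gen [set x].

Definition centraliser_set A : set G :=
  [set g | {in A, forall x, commute g x}].

Fact centraliser_closed A : group_closed [in centraliser_set A].
Proof.
split=> [|x y /set_mem Ax /set_mem Ay]; apply/mem_set => z Az.
  exact: commute_sym (commute1 _).
apply/commute_sym/commuteM; first exact/commute_sym/Ax.
exact/commuteV/commute_sym/Ay.
Qed.

Definition centraliser A := Subgroup (centraliser_closed A).

Definition normaliser_set A : set G := [set g | conjset g A = A].

Lemma conjset1 A : conjset 1 A = A.
Proof.
rewrite predeqE => x; split=> [[y Ay <-]|Ax]; last exists x => //.
  by rewrite invg1 mulg1 mul1g.
by rewrite invg1 mulg1 mul1g.
Qed.

Lemma conjsetM g h A : conjset (g * h) A = conjset g (conjset h A).
Proof.
rewrite predeqE => x; split=> [[y Ay <-]|[_ [y Ay <-] <-]].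
  by exists (h * y * h^-1); [exists y | rewrite invgM !mulgA].
by exists y => //; rewrite invgM !mulgA.
Qed.

Fact normaliser_closed A : group_closed [in normaliser_set A].
Proof.
split=> [|x y /set_mem Ax /set_mem Ay]; apply/mem_set; first exact: conjset1.
have AyV : conjset y^-1 A = A by rewrite -[in LHS]Ay -conjsetM mulVg conjset1.
by rewrite /normaliser_set /= conjsetM AyV.
Qed.

Definition normaliser A := Subgroup (normaliser_closed A).

Fact conjsub_closed g H : group_closed [in conjset g H].
Proof.
split=> [|_ _ /set_mem[x Hx <-] /set_mem[y Hy <-]]; apply/mem_set.
  by exists 1; [exact/set_mem/subgroup1 | rewrite mulg1 mulgV].
exists (x / y); first exact/set_mem/subgroupF/mem_set/Hy/mem_set/Hx.
by rewrite !invgM invgK !mulgA mulgVK.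
Qed.

Definition conjsub g H := Subgroup (conjsub_closed g H).

End Subgroups.

(* As in MathComp's quotient.v, coset_of N is the group N_G(N)/N, whose elements
   are cosets, multiplied as sets; H/N is a subgroup of it when H normalises N. *)
Section Quotients.
Local Open Scope group_scope.
Local Open Scope classical_set_scope.

Variables (G : groupType) (N : subgroup G).

Definition is_coset : pred (set G) :=
  fun X => `[< exists2 x, x \in normaliser N & X = lcoset x N >].

Definition coset_of := {X : set G | is_coset X}.
HB.instance Definition _ := SubChoice.on coset_of.

Canonical coset_predType :=
  PredType (fun (X : coset_of) x => x \in (val X : set G)).

Implicit Types X Y Z : coset_of.

Lemma normaliserP x y : x \in normaliser N -> (x * y * x^-1 \in N) = (y \in N).
Proof.
move=> /set_mem NNx; rewrite -[RHS]/(y \in (N : set G)) -[LHS]/(_ \in (N : set G)).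
apply/idP/idP => /set_mem Ny; last first.
  by apply/mem_set; rewrite -[X in X _]NNx; exists y.
move: Ny; rewrite -[X in X _]NNx => -[z Nz].
by move/mulIg/mulgI => <-; apply/mem_set.
Qed.

Lemma mem_lcoset x y : (y \in lcoset x N) = (x^-1 * y \in N).
Proof.
apply/idP/idP => [/set_mem[z Nz <-]|Nxy]; first by rewrite mulKg; apply/mem_set.
by apply/mem_set; exists (x^-1 * y); [apply/set_mem | rewrite mulVKg].
Qed.

Lemma lcoset_eq x y : (y \in lcoset x N) -> lcoset y N = lcoset x N.
Proof.
rewrite mem_lcoset => Nxy; rewrite predeqE => z; split=> /mem_set; rewrite mem_lcoset => Nz;
  apply/set_mem; rewrite mem_lcoset.
  by have := subgroupM Nxy Nz; rewrite mulgA mulgK.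
by have := subgroupM (subgroupV Nxy) Nz; rewrite invgM invgK mulgA mulgK.
Qed.

Lemma coset_rep X : exists2 x, x \in normaliser N & val X = lcoset x N.
Proof. exact/asboolP/(valP X). Qed.

Fact coset_one_subproof : is_coset N.
Proof.
apply/asboolP; exists 1; first exact: subgroup1.
rewrite predeqE => x; split=> [Nx|[y Ny <-]]; last by rewrite mul1g.
by exists x; rewrite ?mul1g.
Qed.

Lemma mul_lcoset x y : y \in normaliser N ->
  mulset (lcoset x N) (lcoset y N) = lcoset (x * y) N.
Proof.
move=> NNy; rewrite predeqE => z; split=> [[_ [a Na <-]] [_ [b Nb <-] <-]|[a Na <-]].
  exists (y^-1 * a * y * b); last by rewrite !mulgA mulgK.
  apply/set_mem/subgroupM; last exact/mem_set.
  by have := normaliserP a (subgroupV NNy); rewrite invgK => ->; apply/mem_set.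
exists x; first by exists 1; [exact/set_mem/subgroup1 | rewrite mulg1].
by exists (y * a); [exists a | rewrite mulgA].
Qed.

Lemma inv_lcoset x : x \in normaliser N ->
  [set y^-1 | y in lcoset x N] = lcoset x^-1 N.
Proof.
move=> NNx; rewrite predeqE => z; split=> [[_ [a Na <-] <-]|[a Na <-]].
  exists (x * a^-1 * x^-1); last by rewrite invgM !mulgA mulVg mul1g.
  by apply/set_mem; rewrite normaliserP //; apply/subgroupV/mem_set.
exists (a^-1 * x); last by rewrite invgM invgK.
exists (x^-1 * a^-1 * x); last by rewrite !mulgA mulgV mul1g.
apply/set_mem; have := normaliserP a^-1 (subgroupV NNx).
by rewrite invgK => ->; apply/subgroupV/mem_set.
Qed.

Fact coset_mul_subproof X Y : is_coset (mulset (val X) (val Y)).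
Proof.
have [[x NNx ->] [y NNy ->]] := (coset_rep X, coset_rep Y).
by apply/asboolP; exists (x * y); rewrite ?mul_lcoset ?subgroupM.
Qed.

Fact coset_inv_subproof X : is_coset [set y^-1 | y in val X].
Proof.
have [x NNx ->] := coset_rep X.
by apply/asboolP; exists x^-1; rewrite ?inv_lcoset ?subgroupV.
Qed.

Definition coset_one : coset_of := Sub _ coset_one_subproof.
Definition coset_mul X Y : coset_of := Sub _ (coset_mul_subproof X Y).
Definition coset_inv X : coset_of := Sub _ (coset_inv_subproof X).

Lemma lcoset1 : lcoset 1 N = N.
Proof.
rewrite predeqE => x; split=> [[y Ny <-]|Nx]; first by rewrite mul1g.
by exists x; rewrite ?mul1g.
Qed.

Fact coset_mulA : associative coset_mul.
Proof.
move=> X Y Z; apply: val_inj => /=.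
have [[x NNx ->] [y NNy ->] [z NNz ->]] := And3 (coset_rep X) (coset_rep Y) (coset_rep Z).
by rewrite !mul_lcoset ?subgroupM // mulgA.
Qed.

Fact coset_mul1 : left_id coset_one coset_mul.
Proof.
move=> X; apply: val_inj => /=; have [x NNx ->] := coset_rep X.
by rewrite -{1}lcoset1 mul_lcoset // mul1g.
Qed.

Fact coset_mulr1 : right_id coset_one coset_mul.
Proof.
move=> X; apply: val_inj => /=; have [x NNx ->] := coset_rep X.
by rewrite -{2}lcoset1 mul_lcoset ?subgroup1 // mulg1.
Qed.

Fact coset_mulV : left_inverse coset_one coset_inv coset_mul.
Proof.
move=> X; apply: val_inj => /=; have [x NNx ->] := coset_rep X.
by rewrite inv_lcoset // mul_lcoset // mulVg lcoset1.
Qed.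

Fact coset_mulrV : right_inverse coset_one coset_inv coset_mul.
Proof.
move=> X; apply: val_inj => /=; have [x NNx ->] := coset_rep X.
by rewrite inv_lcoset // mul_lcoset ?subgroupV // mulgV lcoset1.
Qed.

HB.instance Definition _ := isGroup.Build coset_of
  coset_mulA coset_mul1 coset_mulr1 coset_mulV coset_mulrV.

Definition quotient_set (H : subgroup G) : set coset_of :=
  [set X | exists2 x, x \in H & val X = lcoset x N].

Fact quotient_closed H : group_closed [in quotient_set H].
Proof.
split=> [|X Y /set_mem[x Hx Xx] /set_mem[y Hy Yy]]; apply/mem_set.
  by exists 1; [exact: subgroup1 | rewrite lcoset1].
have [z NNz Yz] := coset_rep Y.
have NNy : y \in normaliser N.
  have zy : y \in lcoset z N.
    by rewrite -Yz Yy mem_lcoset mulVg subgroup1.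
  rewrite mem_lcoset in zy; rewrite -[y](mulVKg z) subgroupM //.
  apply/mem_set; move: (z^-1 * y) zy => w Nw; change (conjset w N = N).
  rewrite predeqE => a; split=> [[b Nb <-]|Na].
    by apply/set_mem/subgroupM/subgroupV => //; apply/subgroupM/mem_set.
  exists (w^-1 * a * w); last by rewrite !mulgA mulgV mul1g mulgK.
  by apply/set_mem/subgroupM => //; apply/subgroupM; [exact: subgroupV | exact/mem_set].
exists (x * y^-1); first exact: subgroupF.
rewrite -[val _]/(mulset (val X) [set t^-1 | t in val Y]) Xx Yy.
by rewrite inv_lcoset // mul_lcoset // subgroupV.
Qed.

End Quotients.

Definition quotient (G : groupType) (H N : subgroup G) : subgroup (coset_of N) :=
  Subgroup (quotient_closed N H).

Section Bijections.
Local Open Scope classical_set_scope.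

Variable T : choiceType.

Definition mutually_inverse : pred ((T -> T) * (T -> T)) :=
  fun fg => `[< cancel fg.1 fg.2 /\ cancel fg.2 fg.1 >].

Record bijection := Bijection {
  bijection_pair : (T -> T) * (T -> T);
  bijection_inverse : mutually_inverse bijection_pair }.

HB.instance Definition _ := [isSub for bijection_pair].
HB.instance Definition _ := [Choice of bijection by <:].

Definition fun_of_bijection (f : bijection) : T -> T := (bijection_pair f).1.
Coercion fun_of_bijection : bijection >-> Funclass.

Implicit Types f g h : bijection.

Lemma bijection_inj f g : f =1 g -> f = g.
Proof.
case: f g => [[f f'] fP] [[g g'] gP] fg; apply: val_inj => /=.
have {}fg : f = g by apply/funext.
have [/= ff' f'f] := asboolP _ fP; have [/= gg' g'g] := asboolP _ gP.
by congr pair => //; apply/funext => x; rewrite -{1}[x]g'g -fg ff'.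
Qed.

Fact bij_one_subproof : mutually_inverse (id, id).
Proof. by apply/asboolP. Qed.

Fact bij_mul_subproof f g :
  mutually_inverse (f \o g, (bijection_pair g).2 \o (bijection_pair f).2).
Proof.
have [ff' f'f] := asboolP _ (bijection_inverse f).
have [gg' g'g] := asboolP _ (bijection_inverse g).
by apply/asboolP; split; apply: can_comp.
Qed.

Fact bij_inv_subproof f :
  mutually_inverse ((bijection_pair f).2, (bijection_pair f).1).
Proof. by have [fK Kf] := asboolP _ (bijection_inverse f); apply/asboolP; split. Qed.

Definition bij_one := Bijection bij_one_subproof.
Definition bij_mul f g := Bijection (bij_mul_subproof f g).
Definition bij_inv f := Bijection (bij_inv_subproof f).

Fact bij_mulA : associative bij_mul.
Proof. by move=> f g h; apply: bijection_inj. Qed.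

Fact bij_mul1 : left_id bij_one bij_mul.
Proof. by move=> f; apply: bijection_inj. Qed.

Fact bij_mulr1 : right_id bij_one bij_mul.
Proof. by move=> f; apply: bijection_inj. Qed.

Fact bij_mulV : left_inverse bij_one bij_inv bij_mul.
Proof.
by move=> f; apply: bijection_inj; have [] := asboolP _ (bijection_inverse f).
Qed.

Fact bij_mulrV : right_inverse bij_one bij_inv bij_mul.
Proof.
by move=> f; apply: bijection_inj; have [] := asboolP _ (bijection_inverse f).
Qed.

HB.instance Definition _ := isGroup.Build bijection
  bij_mulA bij_mul1 bij_mulr1 bij_mulV bij_mulrV.

End Bijections.

Section UnitGroup.
Local Open Scope ring_scope.

Variable R : unitRingType.

Definition units_of := {x : R | x \is a GRing.unit}.
HB.instance Definition _ := SubChoice.on units_of.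

Implicit Types x y z : units_of.

Fact units_one_subproof : (1 : R) \is a GRing.unit. Proof. exact: unitr1. Qed.

Fact units_mul_subproof x y : val x * val y \is a GRing.unit.
Proof. by rewrite unitrMl ?(valP x) ?(valP y). Qed.

Fact units_inv_subproof x : (val x)^-1 \is a GRing.unit.
Proof. by rewrite unitrV (valP x). Qed.

Definition units_one : units_of := exist _ (1 : R) units_one_subproof.
Definition units_mul x y : units_of := exist _ (val x * val y) (units_mul_subproof x y).
Definition units_inv x : units_of := exist _ (val x)^-1 (units_inv_subproof x).

Fact units_mulA : associative units_mul.
Proof. by move=> x y z; apply: val_inj => /=; rewrite mulrA. Qed.

Fact units_mul1 : left_id units_one units_mul.
Proof. by move=> x; apply: val_inj => /=; rewrite mul1r. Qed.

Fact units_mulr1 : right_id units_one units_mul.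
Proof. by move=> x; apply: val_inj => /=; rewrite mulr1. Qed.

Fact units_mulV : left_inverse units_one units_inv units_mul.
Proof. by move=> x; apply: val_inj => /=; rewrite mulVr // (valP x). Qed.

Fact units_mulrV : right_inverse units_one units_inv units_mul.
Proof. by move=> x; apply: val_inj => /=; rewrite mulrV // (valP x). Qed.

HB.instance Definition _ := isGroup.Build units_of
  units_mulA units_mul1 units_mulr1 units_mulV units_mulrV.

End UnitGroup.

Section Cohomology.
Local Open Scope group_scope.
Local Open Scope classical_set_scope.

Definition class_of (T : Type) (A : set T) (R : T -> T -> Prop) (x : T) : set T :=
  [set y | A y /\ R x y].

Definition classes (T : Type) (A : set T) (R : T -> T -> Prop) : set (set T) :=
  [set class_of A R x | x in A].

Record group_action (W A : groupType) := GroupAction {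
  action_fun :> W -> A -> A;
  action1 : forall a, action_fun 1 a = a;
  actionM : forall w w' a, action_fun (w * w') a = action_fun w (action_fun w' a);
  action_mul : forall w a b, action_fun w (a * b) = action_fun w a * action_fun w b }.

Variables (W A : groupType) (act : group_action W A).

Definition cocycle (c : W -> A) := forall w w', c (w * w') = c w * act w (c w').

Definition cohomologous (c d : W -> A) :=
  exists a, forall w, d w = a^-1 * c w * act w a.

Definition H1 : set (set (W -> A)) := classes cocycle cohomologous.

End Cohomology.

Section DivisionAlgebra.
Local Open Scope ring_scope.
Local Open Scope classical_set_scope.

Variables (p : nat) (p_pr : prime p).
Variables (D : falgType (padic_num p_pr)).

Definition padic_scalar (a : padic_int p_pr) : D := (FracField.tofrac a)%:A.

(* v x is only meaningful for x != 0. Since every nonzero p-adic number is a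
   unit of the p-adic integers times a power of p, the last two fields say that
   v extends the p-adic valuation. *)
Record padic_valuation (v : D -> rat) : Prop := {
  valuationM : forall x y : D, x != 0 -> y != 0 -> v (x * y) = v x + v y;
  valuationD : forall x y : D, x != 0 -> y != 0 -> x + y != 0 ->
    Num.min (v x) (v y) <= v (x + y);
  valuation_unit : forall a, a \is a GRing.unit -> v (padic_scalar a) = 0;
  valuation_p : v p%:R = 1 }.

(* The Hasse invariant of a central division algebra of dimension n^2 is the
   class modulo 1 of v(g), for any g whose inner automorphism x |-> g x g^-1
   induces the Frobenius automorphism on an unramified subfield of degree n;
   such a subfield is generated by a primitive (p^n - 1)-th root of unity w, and
   its Frobenius automorphism is the one that maps w to w^p. *)
Definition has_Hasse_invariant (v : D -> rat) (n : nat) (r : rat) :=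
  exists w g : D, [/\ (p ^ n).-1.-primitive_root w, g \is a GRing.unit,
    g * w * g^-1 = w ^+ p & v g - r \is a Num.int].

Record central_division_algebra (n : nat) : Prop := {
  division_unit : forall x : D, x != 0 -> x \is a GRing.unit;
  central_scalar : forall x : D, (forall y, x * y = y * x) -> x \in 1%VS;
  division_dim : \dim {:D} = (n ^ 2)%N }.

Definition Zp_order (O : set D) :=
  GRing.subring_closed [in O] /\
  exists s : seq D, <<s>>%VS = fullv /\
    O = [set \sum_(i < size s) padic_scalar (a i) * s`_i
          | a in [set: nat -> padic_int p_pr]].

Definition maximal_order (O : set D) :=
  Zp_order O /\ forall O' : set D, Zp_order O' -> O `<=` O' -> O' = O.

(* The group S_n of units of the maximal order, and the kernel of its reduction
   modulo the maximal ideal {v > 0}. *)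
Definition order_units (O : set D) : set (units_of D) :=
  [set x | val x \in O /\ (val x)^-1 \in O].

Definition strict_units (v : D -> rat) (O : set D) : set (units_of D) :=
  [set x | x \in order_units O /\ (val x = 1 \/ 0 < v (val x - 1))].

Definition is_gen_subalgebra (S : set D) (K : {aspace D}) :=
  [/\ 1 \in K, S `<=` [set` K] &
    forall K' : {aspace D}, 1 \in K' -> S `<=` [set` K'] -> (K <= K')%VS].

Lemma gen_subalgebra_exists (S : set D) : exists K, is_gen_subalgebra S K.
Proof.
pose P d := `[< exists s : seq D, [set` s] `<=` S /\ \dim <<s>> = d >].
have P0 : exists d, P d by exists 0%N; apply/asboolP; exists [::]; rewrite span_nil dimv0.
have Pmax d : P d -> (d <= \dim {:D})%N.
  by move=> /asboolP[s [_ <-]]; apply/dimvS/subvf.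
have [d /asboolP[s [sS <-]] smax] := ex_maxnP P0 Pmax.
exists (agenv_aspace <<s>>); split=> [|x Sx|K' K'1 SK'] /=.
- by rewrite memvE sub1_agenv.
- rewrite (subvP (sub_agenv _)) //; have ssx : (<<s>> <= <<x :: s>>)%VS.
    by rewrite span_cons addvSr.
  have /eqP-> : <<s>>%VS == <<x :: s>>%VS; last by rewrite memv_span ?mem_head.
  rewrite eqEdim ssx smax //; apply/asboolP; exists (x :: s); split=> // y /=.
  by rewrite inE => /predU1P[->|/sS].
have sK' : (<<s>> <= K')%VS by apply/span_subvP => y /sS/SK'.
apply: agenv_sub_modl; first by rewrite -memvE.
by apply: subv_trans (prodvSl _ sK') _; rewrite prodv_id.
Qed.

(* The default value of xget is never used, by gen_subalgebra_exists. *)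
Definition gen_subalgebra (S : set D) : {aspace D} :=
  xget {:D}%AS (is_gen_subalgebra S).

Lemma gen_subalgebraP (S : set D) : is_gen_subalgebra S (gen_subalgebra S).
Proof. exact: (@xgetPex _ _ (is_gen_subalgebra S) (gen_subalgebra_exists S)). Qed.

Definition Qp_adjoin (H : set (units_of D)) : {aspace D} :=
  gen_subalgebra [set val x | x in H].

(* In a division algebra, these are the nonzero elements of Q_p(H). *)
Definition Qp_adjoin_units (H : set (units_of D)) : set (units_of D) :=
  [set x | val x \in Qp_adjoin H].

(* The direct implication says that the map induced by v, from H/K to the
   rationals modulo M, is injective; the converse one, that it is well defined. *)
Definition valuation_injects (v : D -> rat) (H K : set (units_of D)) (M : set rat) :=
  {in H &, forall x y : units_of D, v (val x) - v (val y) \in M <-> (y^-1 * x)%g \in K}.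

Section Setting.

Variables (v : D -> rat) (O : set D) (pu : units_of D).
Implicit Types (F : subgroup (units_of D)).

Definition exceptional (n : nat) F0 F : Prop :=
  [/\ p = 2%N, (n %% 4 = 2)%N,
      isomorphic (F0 `&` strict_units v O) [set: 'I_4]
    & isomorphic (F `&` strict_units v O) [set: extremal.quaternion_gtype 8]]
  /\ isomorphic (prime_to_part p (center_set (F `&` order_units O))) (prime_to_part p F0).

Definition Fu_set F0 F2 : set (subgroup (units_of D)) :=
  [set F3 | [/\ (F3 : set _) `<=` normaliser F0,
                finite_index (cycle_gen pu) F3,
                F3 `&` centraliser F0 = F2
              & (F3 : set _) `<=` normaliser F2]].

Variables (L : {aspace D}).

Definition field_part (H : set (units_of D)) : set (subvs_of L) :=
  [set y | exists2 x, x \in H & vsval y = val x].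

Definition field_aut F2 F0 : set (bijection (subvs_of L)) :=
  [set f | [/\ {morph f : x y / x + y}, {morph f : x y / x * y},
               f @` field_part F2 = field_part F2 & f @` field_part F0 = field_part F0]].

Definition group_aut F : set (bijection (subg_of F)) :=
  [set w | {morph w : x y / (x * y)%g}].

Definition restricts_to F0 (f : bijection (subvs_of L)) (w : bijection (subg_of F0)) :=
  forall (x : subg_of F0) (y : subvs_of L),
    vsval y = val (val x) -> vsval (f y) = val (val (w x)).

Definition is_lift F2 F0 (W : subgroup (bijection (subg_of F0)))
    (W' : subgroup (bijection (subvs_of L))) :=
  [/\ (W' : set _) `<=` field_aut F2 F0,
      {in W', forall f, exists2 w, w \in W & restricts_to f w}
    & {in W, forall w, exists! f, f \in W' /\ restricts_to f w}].

Definition conj_on_field (g : units_of D) (f : bijection (subvs_of L)) :=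
  forall y, vsval (f y) = val g * vsval y * (val g)^-1.

Definition conj_on_group F0 (g : units_of D) (w : bijection (subg_of F0)) :=
  forall x, val (w x) = (g * val x * g^-1)%g.

(* The F3 such that F3/F2, identified with its image in Aut(L, F2, F0), is the
   lift W' of W. *)
Definition FuW_set F0 F2 (W' : subgroup (bijection (subvs_of L))) :
    set (subgroup (units_of D)) :=
  [set F3 | [/\ Fu_set F0 F2 F3,
                {in F3, forall g, exists2 f, f \in W' & conj_on_field g f}
              & {in W', forall f, exists2 g, g \in F3 & conj_on_field g f}]].

End Setting.

End DivisionAlgebra.

Arguments group_aut {p p_pr D} F.
Arguments is_lift {p p_pr D L} F2 F0 W W'.
Arguments field_aut {p p_pr D} L F2 F0.

(* Main.v *)
Require Import Defs.
From mathcomp Require Import all_boot all_order all_algebra falgebra.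
From mathcomp Require Import all_classical.

Set Implicit Arguments.
Unset Strict Implicit.
Unset Printing Implicit Defensive.

Import GRing.Theory.
Local Open Scope classical_set_scope.
Local Open Scope ring_scope.

(* Let K be the group of those g which act on L by conjugation through W', and
   hence on F0 through W, and let C be the centraliser of F2. Since W' lifts W,
   C is the kernel of K -> W, and the members of the set F_u(N(F0), F2, W) are
   exactly the subgroups F of K which map onto W and satisfy F cap C = F2; that
   <pu> has finite index in F comes for free from F3. Hence the quotients F/F2
   are the complements of C/F2 in K/F2, and once the complement F3/F2 is fixed,
   the others are classified up to C-conjugacy by H^1(W, C/F2). *)

(** * Subgroups, conjugation and cosets *)

Section SubgroupTheory.
Local Open Scope group_scope.
Variable G : groupType.
Implicit Types H K N : subgroup G.

Lemma subgroup_ext H K : (forall x, x \in H <-> x \in K) -> H = K.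
Proof.
case: H K => [A Ap] [B Bp] /= AB.
have {}AB : A = B by rewrite predeqE => x; split=> /mem_set/AB/set_mem.
by case: _ / AB Bp => Bp; congr Subgroup; exact: Prop_irrelevance.
Qed.

Lemma mem_gen (A : set G) x : A x -> x \in gen A.
Proof. by move=> Ax; apply/mem_set => H AH; exact/mem_set/AH. Qed.

Lemma mem_conjsub g x H : (x \in conjsub g H) = (g^-1 * x * g \in H).
Proof.
apply/idP/idP => [/set_mem[y Hy <-]|Hx].
  by rewrite !mulgA mulVg mul1g mulgVK; exact/mem_set.
apply/mem_set; exists (g^-1 * x * g); first exact/set_mem.
by rewrite !mulgA mulgV mul1g mulgK.
Qed.

Lemma conjsub1 H : conjsub 1 H = H.
Proof. by apply: subgroup_ext => x; rewrite mem_conjsub invg1 mul1g mulg1. Qed.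

Lemma conjsubM g h H : conjsub (g * h) H = conjsub g (conjsub h H).
Proof. by apply: subgroup_ext => x; rewrite !mem_conjsub invgM !mulgA. Qed.

Section ConjugacyBySubgroup.
Variable C : subgroup G.

Definition conj_by H K := exists2 x, x \in C & K = conjsub x H.

Lemma conj_by_refl H : conj_by H H.
Proof. by exists 1; rewrite ?subgroup1 ?conjsub1. Qed.

Lemma conj_by_sym H K : conj_by H K -> conj_by K H.
Proof.
by case=> x Cx ->; exists x^-1; rewrite ?subgroupV // -conjsubM mulVg conjsub1.
Qed.

Lemma conj_by_trans H K N : conj_by H K -> conj_by K N -> conj_by H N.
Proof.
case=> x Cx -> [y Cy ->]; exists (y * x); rewrite ?subgroupM //.
by rewrite conjsubM.
Qed.

End ConjugacyBySubgroup.

Section Cosets.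
Variable N : subgroup G.
Implicit Types X Y : coset_of N.

Lemma mem_cosetM X Y a b : a \in X -> b \in Y -> a * b \in (X * Y : coset_of N).
Proof. by move=> /set_mem Xa /set_mem Yb; apply/mem_set; exists a => //; exists b. Qed.

Lemma mem_cosetV X a : a \in X -> a^-1 \in (X^-1 : coset_of N).
Proof. by move=> /set_mem Xa; apply/mem_set; exists a. Qed.

(** Identities between cosets, such as the cocycle identity, are proved below by exhibiting a common
    representative. *)
Lemma coset_inj X Y a : a \in X -> a \in Y -> X = Y.
Proof.
have [[x _ Xx] [y _ Yy]] := (coset_rep X, coset_rep Y).
rewrite -[a \in X]/(a \in val X) -[a \in Y]/(a \in val Y) Xx Yy => xa ya.
by apply: val_inj; rewrite [LHS]Xx [RHS]Yy -(lcoset_eq xa) (lcoset_eq ya).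
Qed.

Lemma mem_coset X a b : a \in X -> (b \in X) = (a^-1 * b \in N).
Proof.
have [x _ Xx] := coset_rep X.
rewrite -[a \in X]/(a \in val X) -[b \in X]/(b \in val X) Xx => xa.
by rewrite -(lcoset_eq xa) mem_lcoset.
Qed.

(** With [Z] the image of [Y] under the action, this is the coboundary formula read on
    representatives: multiplying by [a] on the left and by the inverse of [b] on the right undoes
    the twist. *)
Lemma mem_coset_twist X Y Z a b t : a \in Y -> b \in Z ->
  (a^-1 * t * b \in (Y^-1 * X * Z : coset_of N)) = (t \in X).
Proof.
move=> Ya Zb; apply/idP/idP => [|Xt]; last by rewrite !mem_cosetM ?mem_cosetV.
move=> /(mem_cosetM Ya)/mem_cosetM/(_ (mem_cosetV Zb)).
by rewrite !mulgA !mulgV !mul1g !mulgK.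
Qed.

End Cosets.
End SubgroupTheory.

(* [C] is the kernel of a partial homomorphism from [G] to [W] whose graph is
   [induces]; complements are then the extensions of [W] by [N] inside the
   extension of [W] by [C] formed by the domain of [induces]. *)
Section Complements.
Local Open Scope group_scope.

Variables (G W : groupType) (N C : subgroup G) (induces : G -> W -> Prop).
Implicit Types (F H : subgroup G) (g h x y : G) (w : W).

Definition complement : set (subgroup G) :=
  [set F | [/\ F `&` C = N,
               {in F, forall g, exists w, induces g w}
             & forall w, exists2 g, g \in F & induces g w]].

Hypothesis induces1 : forall g, induces g 1 <-> g \in C.
Hypothesis inducesM : forall g h w w',
  induces g w -> induces h w' -> induces (g * h) (w * w').
Hypothesis inducesV : forall g w, induces g w -> induces g^-1 w^-1.
Hypothesis induces_inj : forall g w w', induces g w -> induces g w' -> w = w'.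
Hypothesis induces_norm : forall g w, induces g w -> g \in normaliser N.

Let Q := subg_of (quotient C N).

(** * Elementary properties of complements *)

Lemma complement_sub F x : complement F -> x \in N -> x \in F.
Proof. by case=> FC _ _; rewrite -[x \in N]/(x \in (N : set G)) -FC in_setI => /andP[]. Qed.

Lemma complement_ker F x : complement F -> x \in F -> x \in C -> x \in N.
Proof.
by case=> FC _ _ Fx Cx; rewrite -[x \in N]/(x \in (N : set G)) -FC in_setI; apply/andP.
Qed.

Lemma complement_subC F x : complement F -> x \in N -> x \in C.
Proof. by case=> FC _ _; rewrite -[x \in N]/(x \in (N : set G)) -FC in_setI => /andP[]. Qed.

Lemma induces_quo g h w : induces g w -> induces h w -> g / h \in C.
Proof. by move=> gw hw; apply/induces1; rewrite -(mulgV w); exact/inducesM/inducesV. Qed.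

Lemma induces_quoV g h w : induces g w -> induces h w -> g^-1 * h \in C.
Proof. by move=> gw hw; apply/induces1; rewrite -(mulVg w); exact/inducesM/hw/inducesV. Qed.

Lemma inducesCl a g w : a \in C -> induces g w -> induces (a * g) w.
Proof. by move=> /induces1 a1 gw; rewrite -[w]mul1g; exact: inducesM. Qed.

Lemma inducesCr a g w : a \in C -> induces g w -> induces (g * a) w.
Proof. by move=> /induces1 a1 gw; rewrite -[w]mulg1; exact: inducesM. Qed.

Lemma quotient_rep (X : Q) : exists a, a \in val X.
Proof.
have /set_mem[x Cx Xx] := valP X; exists x.
by rewrite -[x \in _]/(x \in val (val X)) Xx mem_lcoset mulVg subgroup1.
Qed.

Variable F3 : subgroup G.
Hypothesis F3P : complement F3.

(** The existence of one complement forces [N] into [C], so a coset of [N] through a point of [C]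
    stays in [C]. *)
Lemma quotient_mem (X : Q) a : a \in val X -> a \in C.
Proof.
have /set_mem[x Cx Xx] := valP X.
rewrite -[a \in _]/(a \in val (val X)) Xx mem_lcoset => xa.
by rewrite -[a](mulVKg x) subgroupM // (complement_subC F3P).
Qed.

Lemma quotient_coset a : a \in C -> exists X : Q, a \in val X.
Proof.
move=> Ca; have Na : is_coset N (lcoset a N).
  by apply/asboolP; exists a => //; apply: induces_norm (iffRL (induces1 a) Ca).
pose X : coset_of N := Sub _ Na.
have QX : X \in (quotient C N : set _).
  by apply/mem_set; exists a.
exists (Sub X QX : Q).
by rewrite -[_ \in _]/(a \in lcoset a N) mem_lcoset mulVg subgroup1.
Qed.

(** The index of [Z] in [F3] bounds both the size of [W] and the number of cosets of [Z] in [N], and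
    [F] is covered by translates of [N] indexed by [W]. *)
Lemma complement_finite_index (Z F : subgroup G) :
  Z `<=` N -> finite_index Z F3 -> complement F -> finite_index Z F.
Proof.
move=> ZN [ZF3 F3fin] FP.
have [_ _ F3onto] := F3P; have [_ Find Fonto] := FP.
have hex w : exists g, g \in F3 /\ induces g w by have [g] := F3onto w; exists g.
have [h hP] := choice hex.
have kex w : exists g, g \in F /\ induces g w by have [g] := Fonto w; exists g.
have [k kP] := choice kex.
(* If [h w] and [h w'] lie in the same coset of [Z], their quotient lies in [N], hence in [C], and
   induces 1; so [W] embeds into the cosets of [Z] in [F3]. *)
have Wfin : finite_set [set: W].
  have -> : [set: W] = (fun w => lcoset (h w) Z) @^-1` [set lcoset x Z | x in F3].
    rewrite predeqE => w; split=> // _.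
    by exists (h w) => //; exact/set_mem/(hP w).1.
  apply: finite_preimage F3fin => w w' _ _ ww'.
  have : h w' \in lcoset (h w) Z by rewrite ww' mem_lcoset mulVg subgroup1.
  rewrite mem_lcoset => /set_mem/ZN/mem_set/(complement_subC F3P)/induces1 w1.
  have := induces_inj w1 (inducesM (inducesV (hP w).2) (hP w').2).
  by move=> E; rewrite -[w']mul1g -(mulgV w) -mulgA -E mulg1.
split=> [x /ZN/mem_set Nx|]; first exact/set_mem/(complement_sub FP).
(* For [x] in [F] over [w], the quotient of [x] by [k w] lies in [N] and so in [F3]: the coset of
   [x] is the translate by [k w] of a coset of [Z] in [F3]. *)
apply: sub_finite_set (finite_image2 (fun w => lcoset (k w)) Wfin F3fin).
move=> _ [x /mem_set Fx <-]; have [w xw] := Find _ Fx.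
have [Fk kw] := kP w; have Nkx : (k w)^-1 * x \in N.
  apply: (complement_ker FP); last exact: induces_quoV kw xw.
  exact/subgroupM/Fx/subgroupV.
exists w => //; exists (lcoset ((k w)^-1 * x) Z).
  by exists ((k w)^-1 * x) => //; exact/set_mem/(complement_sub F3P).
rewrite predeqE => y; split=> [[_ [z Zz <-] <-]|[z Zz <-]].
  by exists z => //; rewrite !mulgA mulgV mul1g.
by exists ((k w)^-1 * x * z); [exists z | rewrite !mulgA mulgV mul1g].
Qed.

(** * Twisting the complement [F3] by cocycles *)

Variable act : group_action W Q.
Hypothesis act_conj : forall w g, g \in F3 -> induces g w ->
  forall (a : Q) x, x \in val a -> g * x * g^-1 \in val (act w a).

Implicit Types c d : W -> Q.

Definition twist_set c : set G :=
  [set x | exists w g, [/\ g \in F3, induces g w & x / g \in val (c w)]].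

(** Generation yields a subgroup for any function [c]; for a cocycle it adds no element, by
    [twistP]. *)
Definition twist c := gen (twist_set c).

Lemma cocycle1 c : cocycle act c -> c 1 = 1.
Proof. by move/(_ 1 1); rewrite mulg1 action1 -{1}[c 1]mulg1 => /mulgI. Qed.

Lemma twist_closed c : cocycle act c -> group_closed [in twist_set c].
Proof.
move=> cP; split=> [|x y /set_mem[w [g [Fg gw cx]]] /set_mem[w' [h [Fh hw' cy]]]].
  apply/mem_set; exists 1, 1; split; first exact: subgroup1.
    by apply/induces1; exact: subgroup1.
  by rewrite cocycle1 // mulgV; exact: subgroup1.
have Fgh : g / h \in F3 by exact: subgroupF.
have ghw : induces (g / h) (w / w') by exact/inducesM/inducesV.
apply/mem_set; exists (w / w'), (g / h); split => //.
(* The cocycle identity at [w / w'] and [w'], solved for its first factor; conjugating [y / h] by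
   [g / h] represents the action that appears in it. *)
have -> : c (w / w') = c w * (act (w / w') (c w'))^-1.
  by have := cP (w / w') w'; rewrite mulgVK => ->; rewrite mulgK.
have := mem_cosetM cx (mem_cosetV (act_conj Fgh ghw cy)).
by rewrite !invgM !invgK !mulgA !mulgVK.
Qed.

Lemma twistP c x : cocycle act c -> (x \in twist c) <-> twist_set c x.
Proof.
move=> cP; split=> [/set_mem/(_ (Subgroup (twist_closed cP)))|/mem_gen //].
by move=> /(_ (@subset_refl _ _))/set_mem.
Qed.

Lemma twist_induces c x : cocycle act c -> x \in twist c -> exists w, induces x w.
Proof.
move=> cP /(twistP _ cP)[w [g [_ gw cx]]]; exists w.
by rewrite -[x](mulgVK g); exact/inducesCl/gw/quotient_mem/cx.
Qed.

(** The choices hidden in [twist_set] do not matter: [w] is determined by [x], and two elements of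
    [F3] over [w] differ by an element of [N], the intersection of [F3] with [C]. *)
Lemma mem_twist c x w g : cocycle act c -> g \in F3 -> induces g w ->
  induces x w -> (x \in twist c) = (x / g \in val (c w)).
Proof.
move=> cP Fg gw xw; apply/idP/idP => [|cx]; last by apply/twistP => //; exists w, g.
move=> /(twistP _ cP)[w' [g' [Fg' gw' cx]]].
have xw' : induces x w'.
  by rewrite -[x](mulgVK g'); exact/inducesCl/gw'/quotient_mem/cx.
have ww' := induces_inj xw' xw; rewrite ww' in cx gw' *.
rewrite (mem_coset _ cx) invgM invgK -mulgA mulKg.
by apply: (complement_ker F3P); [exact: subgroupF | exact: induces_quo gw' gw].
Qed.

Lemma twist_complement c : cocycle act c -> complement (twist c).
Proof.
have [_ F3ind F3onto] := F3P.
move=> cP; split=> [|x cx|w]; last first.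
- have [[g Fg gw] [a ca]] := (F3onto w, quotient_rep (c w)).
  have agw : induces (a * g) w := inducesCl (quotient_mem ca) gw.
  by exists (a * g) => //; rewrite (mem_twist cP Fg gw) // mulgK.
- exact: twist_induces cx.
(* Over 1 one may take [g = 1], and [c 1] is the trivial coset [N]. *)
have E1 x : x \in C -> (x \in twist c) = (x \in N).
  move=> /induces1 x1.
  rewrite (mem_twist cP (subgroup1 F3) (iffRL (induces1 1) (subgroup1 C)) x1).
  by rewrite cocycle1 // invg1 mulg1.
rewrite predeqE => x; split=> [[/mem_set cx /mem_set Cx]|/mem_set Nx].
  by apply/set_mem; have := cx; rewrite E1.
have Cx := complement_subC F3P Nx.
by split; apply/set_mem; rewrite -?[_ \in _]/(x \in twist c) ?E1.
Qed.

(** An element of the twist over [w] differs from [c' w * s w] by an element of [N]. Hence the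
    generated subgroup depends neither on the section nor on the representatives. *)
Lemma gen_twist c (s c' : W -> G) : cocycle act c ->
  (forall w, s w \in F3 /\ induces (s w) w) -> (forall w, c' w \in val (c w)) ->
  gen (N `|` [set c' w * s w | w in [set: W]]) = twist c.
Proof.
move=> cP sP c'P; apply: subgroup_ext => x.
have csw w : induces (c' w * s w) w.
  by apply: inducesCl (sP w).2; exact: quotient_mem (c'P w).
have cst w : c' w * s w \in twist c.
  by have [Fs sw] := sP w; rewrite (mem_twist cP Fs sw) // mulgK.
split=> [/set_mem xS|cx].
  apply: xS => y [/mem_set Ny|[w _ <-]]; apply/set_mem => //.
  exact: complement_sub (twist_complement cP) Ny.
have [w xw] := twist_induces cP cx.
rewrite -[x](mulVKg (c' w * s w)); apply: subgroupM.
  by apply: mem_gen; right; exists w.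
apply: mem_gen; left; apply/set_mem.
apply: (complement_ker (twist_complement cP)).
  exact/subgroupM/cx/subgroupV.
exact: induces_quoV.
Qed.

(** Conjugating [b * g] by [x] and dividing by [g] gives [x * b * (g * x^-1 * g^-1)], which is the
    coboundary formula for the class [a] of [x^-1]. *)
Lemma twist_conj c d : cocycle act c -> cocycle act d ->
  conj_by C (twist c) (twist d) <-> cohomologous act c d.
Proof.
have [_ _ F3onto] := F3P.
move=> cP dP; split=> [[x Cx dE]|[a dE]].
  have [a xa] := quotient_coset (subgroupV Cx); exists a => w.
  have [[g Fg gw] [b cb]] := (F3onto w, quotient_rep (c w)).
  have bgw : induces (b * g) w := inducesCl (quotient_mem cb) gw.
  apply/val_inj/(@coset_inj _ _ _ _ (x * (b * g) * x^-1 / g)).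
    rewrite -(mem_twist dP Fg gw).
      by rewrite dE mem_conjsub !mulgA mulVg mul1g mulgVK (mem_twist cP Fg gw) ?mulgK.
    by apply: inducesCr; rewrite ?subgroupV //; exact: inducesCl.
  have -> : x * (b * g) * x^-1 / g = (x^-1)^-1 * b * (g * x^-1 * g^-1).
    by rewrite invgK !mulgA.
  by rewrite mem_coset_twist //; exact: act_conj.
have [t ta] := quotient_rep a; have Ct := quotient_mem ta.
exists t^-1; first exact: subgroupV.
(* All elements of both subgroups induce some [w], so they may be compared fibre by fibre over
   [W]. *)
suff E w y : induces y w -> (y \in twist d) = (y \in conjsub t^-1 (twist c)).
  apply: subgroup_ext => y; split=> yt.
    by have [w yw] := twist_induces dP yt; rewrite -(E w).
  have : exists w, induces (t * y * t^-1) w.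
    by apply: twist_induces cP _; rewrite mem_conjsub invgK in yt.
  case=> w yw; rewrite (E w) //.
  have := inducesCl (subgroupV Ct) (inducesCr Ct yw).
  by rewrite !mulgA mulVg mul1g mulgVK.
move=> yw; have [g Fg gw] := F3onto w.
rewrite mem_conjsub invgK (mem_twist dP Fg gw yw) (mem_twist cP Fg gw); last first.
  exact/inducesCr/inducesCl/yw/Ct/subgroupV.
rewrite dE -[RHS](mem_coset_twist _ _ ta (act_conj Fg gw ta)).
by rewrite !mulgA mulVg mul1g !mulgVK.
Qed.

(** The cocycle measures the difference between [F] and [F3]: its value at [w] is the class of
    [h / g], where [h] in [F] and [g] in [F3] both induce [w]. *)
Lemma complement_twist F : complement F -> exists2 c, cocycle act c & F = twist c.
Proof.
move=> FP; have [_ F3ind F3onto] := F3P; have [_ Find Fonto] := FP.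
have cex w : exists X : Q, forall h g, h \in F -> g \in F3 ->
    induces h w -> induces g w -> h / g \in val X.
  have [[h0 Fh0 hw0] [g0 Fg0 gw0]] := (Fonto w, F3onto w).
  have [X hgX] := quotient_coset (induces_quo hw0 gw0).
  exists X => h g Fh Fg hw gw; rewrite (mem_coset _ hgX).
  (* Another choice of [h] and [g] changes [h / g] by a conjugate, under [g0], of an element of [N],
     and [g0] normalises [N]. *)
  have -> : (h0 / g0)^-1 * (h / g) = g0 * ((h0^-1 * h) * (g^-1 * g0)) * g0^-1.
    by rewrite invgM invgK !mulgA mulgK.
  rewrite normaliserP; last exact: induces_norm gw0.
  apply: subgroupM.
    by apply: (complement_ker FP); [exact/subgroupM/Fh/subgroupV | exact: induces_quoV hw0 hw].
  by apply: (complement_ker F3P); [exact/subgroupM/Fg0/subgroupV | exact: induces_quoV gw gw0].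
have [c cE] := choice cex.
have cP : cocycle act c.
  move=> w w'; have [[h Fh hw] [g Fg gw]] := (Fonto w, F3onto w).
  have [[h' Fh' hw'] [g' Fg' gw']] := (Fonto w', F3onto w').
  apply/val_inj/(@coset_inj _ _ _ _ ((h * h') / (g * g'))).
    by apply: cE; rewrite ?subgroupM //; exact: inducesM.
  have -> : (h * h') / (g * g') = (h / g) * (g * (h' / g') * g^-1).
    by rewrite invgM !mulgA mulgVK.
  by apply: mem_cosetM; [exact: cE | exact/act_conj/cE].
exists c => //; apply: subgroup_ext => x; split=> [Fx|cx].
  have [w xw] := Find _ Fx; have [g Fg gw] := F3onto w.
  by rewrite (mem_twist cP Fg gw) //; exact: cE.
have [w xw] := twist_induces cP cx.
have [[h Fh hw] [g Fg gw]] := (Fonto w, F3onto w).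
move: cx; rewrite (mem_twist cP Fg gw xw) (mem_coset _ (cE w h g Fh Fg hw gw)).
(* The two representatives differ by the conjugate of [h^-1 * x] under [g], so [h^-1 * x] lies in
   [N], which is contained in [F]. *)
rewrite invgM invgK -mulgA [_ * (x / g)]mulgA mulgA normaliserP; last exact: induces_norm gw.
by move=> /(complement_sub FP) Fhx; rewrite -[x](mulVKg h) subgroupM.
Qed.

Theorem H1_complements :
  exists psi : set (W -> Q) -> set (subgroup G),
    set_bij (H1 act) (classes complement (conj_by C)) psi /\
    forall c, cocycle act c ->
    forall s : W -> G, (forall w, s w \in F3 /\ induces (s w) w) ->
    forall c' : W -> G, (forall w, c' w \in val (c w)) ->
    let F := gen (N `|` [set c' w * s w | w in [set: W]]) in
      complement F /\
      psi (class_of (cocycle act) (cohomologous act) c) =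
        class_of complement (conj_by C) F.
Proof.
(* Taking all complements conjugate to a twist by some member of [X] avoids choosing a cocycle in
   each class. *)
pose psi (X : set (W -> Q)) : set (subgroup G) :=
  [set F | complement F /\ exists2 c, X c & conj_by C (twist c) F].
have psiE c : cocycle act c -> psi (class_of (cocycle act) (cohomologous act) c) =
    class_of complement (conj_by C) (twist c).
  move=> cP; rewrite predeqE => F; split=> [[FP [d [dP /(twist_conj cP dP) cd] dF]]|[FP cF]].
    by split=> //; exact: conj_by_trans dF.
  split=> //; exists c => //; split=> //.
  exact/(twist_conj cP cP)/conj_by_refl.
exists psi; split; last first.
  move=> c cP s sP c' c'P /=; rewrite (gen_twist cP sP c'P).
  by split; [exact: twist_complement | exact: psiE].
split.
- move=> _ [c cP <-]; rewrite psiE //; exists (twist c) => //; exact: twist_complement.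
- move=> _ _ /set_mem[c cP <-] /set_mem[d dP <-]; rewrite !psiE // => cd.
  (* [twist d] belongs to its own class, hence to that of [twist c]. The symmetry and transitivity
     needed for [cohomologous] are then borrowed from conjugacy through [twist_conj]. *)
  have [_ ccd] : class_of complement (conj_by C) (twist c) (twist d).
    by rewrite cd; split; [exact: twist_complement | exact: conj_by_refl].
  rewrite predeqE => e; split=> -[eP ce]; split=> //.
    apply/(twist_conj dP eP); apply: conj_by_trans (conj_by_sym ccd) _.
    exact/(twist_conj cP eP).
  apply/(twist_conj cP eP); apply: conj_by_trans ccd _.
  exact/(twist_conj dP eP).
move=> _ [F FP <-]; have [c cP FE] := complement_twist FP.
exists (class_of (cocycle act) (cohomologous act) c); first by exists c.
by rewrite psiE // FE.
Qed.

End Complements.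

(** * Conjugation on [L] and on [F0] *)

Section ConjugationOnField.

Variables (p : nat) (p_pr : prime p) (D : falgType (padic_num p_pr)).
Implicit Types (F : subgroup (units_of D)) (L : {aspace D}) (g h x : units_of D).

Lemma Qp_adjoin_sub F x : x \in F -> val x \in Qp_adjoin F.
Proof.
move=> Fx; have [_ FL _] := gen_subalgebraP [set val y | y in F]; apply: FL; exists x => //; exact/set_mem.
Qed.

(** The centraliser of [x] in [D] is a subalgebra containing [F], so by minimality it contains the
    subalgebra generated by [F]. *)
Lemma Qp_adjoin_commute F x (y : D) :
  x \in centraliser F -> y \in Qp_adjoin F -> val x * y = y * val x.
Proof.
move=> /set_mem CFx; have [_ _ minL] := gen_subalgebraP [set val z | z in F].
have /subvP sub : (Qp_adjoin F <= 'C[val x])%VS.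
  apply: minL => [|_ [z Fz <-]]; first by apply/cent1vP; rewrite mul1r mulr1.
  by apply/cent1vP; have /(congr1 val) := CFx z (mem_set Fz).
by move=> /sub/cent1vP.
Qed.

Lemma conj_on_field_eq L g (f : bijection (subvs_of L)) x (y : subvs_of L) :
  conj_on_field g f -> vsval y = val x -> vsval (f y) = val (g * x * g^-1)%g.
Proof. by move=> gf yx; rewrite [LHS]gf yx. Qed.

Lemma conj_on_field_norm L F g (f : bijection (subvs_of L)) :
  (forall x, x \in F -> val x \in L) -> f @` field_part (L := L) F = field_part (L := L) F ->
  conj_on_field g f -> g \in normaliser F.
Proof.
move=> FL fF gf; apply/mem_set; change (conjset g F = F); rewrite predeqE => x; split.
  move=> [z Fz <-]; pose y := Subvs (FL z (mem_set Fz)).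
  have : field_part (L := L) F (f y) by rewrite -fF; exists y => //; exists z => //; exact/mem_set.
  move=> [z' Fz' fy]; have <- : z' = (g * z * g^-1)%g; last exact/set_mem.
  by apply: val_inj; rewrite /= -fy; apply: conj_on_field_eq gf _.
move=> /mem_set Fx; pose y := Subvs (FL x Fx).
have : field_part (L := L) F y by exists x.
rewrite -fF => -[y' [z Fz yz] fy]; exists z; first exact/set_mem.
by apply: val_inj; rewrite /= -[RHS]/(vsval y) -fy; apply/esym/conj_on_field_eq.
Qed.

(** * From the lift [W'] of [W] to complements *)

Section Lift.

Variables (F0 F2 : subgroup (units_of D)) (L : {aspace D}).
Variables (W : subgroup (bijection (subg_of F0))) (W' : subgroup (bijection (subvs_of L))).
Hypotheses (LE : L = Qp_adjoin F2) (F0_F2 : F0 `<=` F2).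
Hypothesis W_lift : is_lift F2 F0 W W'.

(** The second clause ties [g] to the chosen lift, since the action on [F0] alone does not determine
    that on [L]. *)
Definition lift_induces g (w : subg_of W) :=
  conj_on_group g (val w) /\ exists2 f, f \in W' & conj_on_field (L := L) g f.

Let F2_L x : x \in F2 -> val x \in L.
Proof. by rewrite LE; exact: Qp_adjoin_sub. Qed.

Let F0_L x : x \in F0 -> val x \in L.
Proof. by move=> /set_mem/F0_F2/mem_set; exact: F2_L. Qed.

Lemma restricts_conj g (f : bijection (subvs_of L)) (w : bijection (subg_of F0)) :
  conj_on_field g f -> conj_on_group g w <-> restricts_to f w.
Proof.
move=> gf; split=> [gw x y yx|fw x].
  by rewrite (conj_on_field_eq gf yx) gw.
by apply: val_inj; rewrite -(fw x (Subvs (F0_L (valP x)))) //; exact: (conj_on_field_eq gf).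
Qed.

Lemma conj_on_field_ex g (f : bijection (subvs_of L)) :
  f \in W' -> conj_on_field g f -> exists w, lift_induces g w.
Proof.
have [_ restr _] := W_lift; move=> W'f gf; have [w Ww fw] := restr f W'f.
by exists (Sub w Ww : subg_of W); split; [exact/(restricts_conj w gf) | exists f].
Qed.

(** The identity of [L] is the only member of [W'] that restricts to the identity of [F0], so [g]
    acts trivially on [L] and centralises [F2]. Conversely, what centralises [F2] centralises the
    algebra [L] it generates. *)
Lemma lift_induces1 g : lift_induces g 1%g <-> g \in centraliser F2.
Proof.
have [_ _ lift_uniq] := W_lift.
have r1 : restricts_to (1%g : bijection (subvs_of L)) (1%g : bijection (subg_of F0)) by [].
split=> [[g1 [f W'f gf]]|CFg].
  have [f' [_ uf]] := lift_uniq 1%g (subgroup1 W).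
  have f1 : f = 1%g.
    rewrite -(uf f); last by split => //; apply/(restricts_conj _ gf).
    by apply: uf; split => //; exact: subgroup1.
  apply/mem_set => x F2x; have gx : x = (g * x * g^-1)%g.
    apply: val_inj; have := conj_on_field_eq (y := Subvs (F2_L F2x)) gf erefl.
    by rewrite f1.
  by rewrite /commute [in RHS]gx mulgVK.
have F0_C x : x \in F0 -> (g * x = x * g)%g.
  by move/set_mem: CFg => + /set_mem/F0_F2/mem_set; apply.
split=> [x|]; first by rewrite (F0_C _ (valP x)) mulgK.
exists 1%g; first exact: subgroup1.
move=> y /=; rewrite (Qp_adjoin_commute CFg) -?LE ?subvsP // mulrK //.
exact: (valP g).
Qed.

Lemma lift_inducesM g h w w' :
  lift_induces g w -> lift_induces h w' -> lift_induces (g * h)%g (w * w')%g.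
Proof.
move=> [gw [f W'f gf]] [hw' [f' W'f' hf']]; split=> [x|].
  by rewrite gw hw' invgM !mulgA.
exists (f * f')%g; first exact: subgroupM.
by move=> y; rewrite gf hf' /= invrM ?(valP g) ?(valP h) // !mulrA.
Qed.

Lemma lift_inducesV g w : lift_induces g w -> lift_induces g^-1%g w^-1%g.
Proof.
have cancelV (T : choiceType) (f : bijection T) (x : T) : f ((f^-1)%g x) = x.
  exact: (congr1 (fun g : bijection T => g x) (mulgV f)).
move=> [gw [f W'f gf]]; split=> [x|].
  have := gw ((val w)^-1%g x); rewrite cancelV invgK => ->.
  by rewrite !mulgA mulVg mul1g mulgVK.
exists f^-1%g; first exact: subgroupV.
move=> y; have := gf (f^-1%g y); rewrite cancelV => ->.
by rewrite /= invrK !mulrA mulVr ?(valP g) // mul1r mulrVK ?(valP g).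
Qed.

Lemma lift_induces_inj g w w' : lift_induces g w -> lift_induces g w' -> w = w'.
Proof.
move=> [gw _] [gw' _]; apply/val_inj/bijection_inj => x.
by apply: val_inj; rewrite gw gw'.
Qed.

Lemma lift_induces_norm g w :
  lift_induces g w -> g \in normaliser F2 /\ g \in normaliser F0.
Proof.
have [Waut _ _] := W_lift.
move=> [_ [f /set_mem/Waut[_ _ fF2 fF0] gf]].
by split; [exact: conj_on_field_norm F2_L fF2 gf | exact: conj_on_field_norm F0_L fF0 gf].
Qed.

(** This trades the centraliser of [F0], used to define [Fu_set], for that of [F2], used for
    complements: an element centralising [F0] induces the trivial [w], which has only the trivial
    lift. *)
Lemma lift_induces_ker g w :
  lift_induces g w -> (g \in centraliser F2) <-> (g \in centraliser F0).
Proof.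
move=> gw; split=> /set_mem CFg.
  by apply/mem_set => x /set_mem/F0_F2/mem_set/CFg.
apply/lift_induces1; suff <- : w = 1%g by [].
case: gw => gw _; apply/val_inj/bijection_inj => x; apply: val_inj.
by rewrite gw (CFg _ (valP x)) mulgK.
Qed.

(** For a complement, the normaliser conditions hold because members of [W'] preserve [F2] and [F0],
    and finiteness of the index is transferred from [F3]. *)
Lemma FuW_complementE (pu : units_of D) F3 :
  cycle_gen pu `<=` F2 -> FuW_set pu F0 F2 W' F3 ->
  FuW_set pu F0 F2 W' = complement F2 (centraliser F2) lift_induces.
Proof.
have [_ _ lift_uniq] := W_lift.
move=> ZF2 F3_mem.
have sub F : FuW_set pu F0 F2 W' F -> complement F2 (centraliser F2) lift_induces F.
  move=> [[FN0 Zfin FC FN2] Fsub Fonto].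
  have Find g : g \in F -> exists w, lift_induces g w.
    by move=> /Fsub[f]; exact: conj_on_field_ex.
  split=> // [|w].
    rewrite -[RHS]FC predeqE => x; split=> -[Fx /mem_set Cx]; split=> //;
    have [w xw] := Find x (mem_set Fx);
    exact/set_mem/(lift_induces_ker xw).
  have [f [[W'f fw] _]] := lift_uniq _ (valP w).
  have [g Fg gf] := Fonto f W'f; exists g => //.
  by split; [exact/(restricts_conj _ gf) | exists f].
have F3P := sub _ F3_mem; have [[_ Zfin3 _ _] _ _] := F3_mem.
rewrite predeqE => F; split=> [/sub //|FP].
have [FC Find Fonto] := FP.
have nF g : (F : set _) g -> g \in normaliser F2 /\ g \in normaliser F0.
  by move=> /mem_set/Find[w]; exact: lift_induces_norm.
split; first split.
- by move=> g /nF[_ /set_mem].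
- exact: (complement_finite_index lift_induces1 lift_inducesM lift_inducesV
    lift_induces_inj F3P ZF2 Zfin3 FP).
- rewrite -[RHS]FC predeqE => x; split=> -[Fx /mem_set Cx]; split=> //;
    have [w xw] := Find x (mem_set Fx);
    exact/set_mem/(lift_induces_ker xw).
- by move=> g /nF[/set_mem].
- by move=> g /Find[w [_ [f W'f gf]]]; exists f.
move=> f W'f; have [_ restr _] := W_lift.
have [w Ww fw] := restr f W'f.
have [g Fg [gw [f' W'f' gf']]] := Fonto (Sub w Ww : subg_of W).
(* The element [g] acts on [L] through some [f'] in [W'], perhaps not visibly [f]; both restrict to
   [w], so uniqueness of the lift identifies them. *)
have [f0 [_ f0E]] := lift_uniq w Ww; exists g => //.
rewrite -(f0E f) // (f0E f') //; split => //.
exact/(restricts_conj _ gf').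
Qed.

End Lift.
End ConjugationOnField.

(** * Classification of the extensions in the division algebra *)

Theorem theorem2p28
  (p : nat) (p_pr : prime p) (n : nat) (n_gt0 : (0 < n)%N) (dvd_n : (p.-1 %| n)%N)
  (D : falgType (padic_num p_pr)) (v : D -> rat)
  (D_central : central_division_algebra D n)
  (v_val : padic_valuation v)
  (D_Hasse : has_Hasse_invariant v n (n%:R^-1))
  (O : set D) (O_max : maximal_order O)
  (u : padic_int p_pr) (u_unit : u \is a GRing.unit)
  (pu : units_of D) (puE : val pu = padic_scalar D (p%:R * u))
  (F0 F1 F2 : subgroup (units_of D))
  (F0_fin : finite_set F0) (F0_ab : abelian_set F0)
  (F0_O : F0 `<=` order_units O)
  (F1_sub : F1 `<=` Qp_adjoin_units F0)
  (F1_ind : finite_index (mulset F0 (cycle_gen pu)) F1)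
  (F1_val : valuation_injects v F1 (mulset F0 (cycle_gen pu))
              [set z | z \is a Num.int])
  (F2_sub : F2 `<=` centraliser F0)
  (F2_ind : finite_index (cycle_gen pu) F2)
  (F2_F1 : F2 `&` Qp_adjoin_units F0 = F1)
  (F2_val : valuation_injects v F2 F1 [set v (val x) | x in F1])
  (F2_ab : abelian_set F2)
  (not_exceptional : forall F, Fu_set pu F0 F2 F -> ~ exceptional v O n F0 F)
  (L : {aspace D}) (LE : L = Qp_adjoin F2)
  (W : subgroup (bijection (subg_of F0))) (W_aut : W `<=` group_aut F0)
  (W' : subgroup (bijection (subvs_of L))) (W_lift : is_lift F2 F0 W W')
  (F3 : subgroup (units_of D)) (F3_mem : FuW_set pu F0 F2 W' F3)
  (act : group_action (subg_of W) (subg_of (quotient (centraliser F2) F2)))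
  (act_conj : forall (w : subg_of W) (g : units_of D), g \in F3 ->
     conj_on_group g (val w) ->
     forall (a : subg_of (quotient (centraliser F2) F2)) (x : units_of D),
       x \in val a -> (g * x * g^-1)%g \in val (act w a)) :
  exists psi : set (subg_of W -> subg_of (quotient (centraliser F2) F2)) ->
               set (subgroup (units_of D)),
    let conj_F2 F F' := exists2 x, x \in centraliser F2 & F' = conjsub x F in
    set_bij (H1 act) (classes (FuW_set pu F0 F2 W') conj_F2) psi /\
    forall c, cocycle act c ->
    forall s : subg_of W -> units_of D,
      (forall w, s w \in F3 /\ conj_on_group (s w) (val w)) ->
    forall c' : subg_of W -> units_of D, (forall w, c' w \in val (c w)) ->
    let F := gen (F2 `|` [set (c' w * s w)%g | w in [set: subg_of W]]) in
      FuW_set pu F0 F2 W' F /\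
      psi (class_of (cocycle act) (cohomologous act) c) =
        class_of (FuW_set pu F0 F2 W') conj_F2 F.
Proof.
have F0_F2 : F0 `<=` F2.
  move=> x F0x; have F1x : (F1 : set _) x.
    by apply: F1_ind.1; exists x => //; exists 1%g; [exact/set_mem/subgroup1 | rewrite mulg1].
  by move: F1x; rewrite -F2_F1 => -[].
have F3C := FuW_complementE LE F0_F2 W_lift F2_ind.1 F3_mem.
have F3P := F3_mem; rewrite F3C in F3P.
have ind1 := lift_induces1 LE F0_F2 W_lift.
have indM := @lift_inducesM _ _ _ _ _ W W'.
have indV := @lift_inducesV _ _ _ _ _ W W'.
have indI := @lift_induces_inj _ _ _ _ _ W W'.
have ind_norm g (w : subg_of W) (gw : lift_induces W' g w) : g \in normaliser F2.
  exact: (lift_induces_norm LE F0_F2 W_lift gw).1.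
(* The action is specified through conjugation on [F0] alone, which is the first clause of
   [lift_induces]. *)
have act_ind (w : subg_of W) (g : units_of D) : g \in F3 -> lift_induces W' g w ->
    forall (a : subg_of (quotient (centraliser F2) F2)) (x : units_of D),
      x \in val a -> (g * x * g^-1)%g \in val (act w a).
  by move=> F3g [gw _]; apply: act_conj F3g gw.
have [psi [psi_bij psiE]] := @H1_complements (units_of D) (subg_of W) F2 (centraliser F2)
  (@lift_induces _ _ _ _ _ W W') ind1 indM indV indI ind_norm F3 F3P act act_ind.
exists psi => conj_F2; rewrite F3C; split=> // c cP s sP; apply: psiE => // w.
(* The section is only known to induce [w] on [F0]; that its values act on [L] through [W'] follows
   from their membership in [F3]. *)
have [F3s sw] := sP w; split=> //; split=> //.
by have [_ F3sub _] := F3_mem; exact: F3sub.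
Qed.
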